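(* Let $\lambda\in K$, let $(A,R,\alpha_{A},\beta_{A})$ be a Rota-Baxter BiHom-associative algebra of weight $\lambda$ with $\alpha_A,\beta_A$ bijective, and let $(M,R,T,\alpha_{M},\beta_{M},\alpha_{A},\beta_{A})$ be a Rota-Baxter paired (left) $(A,\mu,\alpha_{A},\beta_{A})$-module of weight $\lambda$, with action $\triangleright$. Define a map $\triangleright_{\star}:A\otimes M\to M$ by $$a\triangleright_{\star}m=R(a)\triangleright m+a\triangleright T(m)+\lambda\,a\triangleright m$$ for all $a\in A$, $m\in M$. Then $(M,\triangleright_{\star},\alpha_{M},\beta_{M})$ is a left $(A,\natural,\alpha_{A},\beta_{A})$-pre-Lie module, where $$a\,\natural\, b=R(a)b-\alpha_A^{-1}\beta_A(b)\,R(\alpha_A\beta_A^{-1}(a))-\lambda\,\alpha_A^{-1}\beta_A(b)\,\alpha_A\beta_A^{-1}(a).$$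
   Context: $K$ is a field; everything is $K$-linear. A BiHom-associative algebra $(A,\mu,\alpha_A,\beta_A)$ is a vector space $A$ with linear maps $\mu:A\otimes A\to A$, $\mu(a\otimes b)=ab$, and commuting $\alpha_A,\beta_A:A\to A$, multiplicative for $\mu$, with $\alpha_A(a)(bc)=(ab)\beta_A(c)$. A Rota-Baxter BiHom-associative algebra $(A,R,\alpha_A,\beta_A)$ of weight $\lambda$ is a BiHom-associative algebra with a linear map $R:A\to A$ commuting with $\alpha_A,\beta_A$ and satisfying $R(a)R(b)=R(R(a)b)+R(aR(b))+\lambda R(ab)$. A left $(A,\mu,\alpha_A,\beta_A)$-module $(M,\triangleright,\alpha_M,\beta_M)$: a vector space $M$ with commuting linear maps $\alpha_M,\beta_M:M\to M$ and linear $\triangleright:A\otimes M\to M$ with $\alpha_M(a\triangleright m)=\alpha_A(a)\triangleright\alpha_M(m)$, $\beta_M(a\triangleright m)=\beta_A(a)\triangleright\beta_M(m)$, $\alpha_A(a)\triangleright(b\triangleright m)=(ab)\triangleright\beta_M(m)$. A Rota-Baxter paired (left) $(A,\mu,\alpha_A,\beta_A)$-module of weight $\lambda$, $(M,R,T,\alpha_M,\beta_M,\alpha_A,\beta_A)$: a left $(A,\mu,\alpha_A,\beta_A)$-module $(M,\triangleright,\alpha_M,\beta_M)$ (that is, a vector space $M$ with commuting linear maps $\alpha_M,\beta_M:M\to M$ and linear $\triangleright:A\otimes M\to M$ with $\alpha_M(a\triangleright m)=\alpha_A(a)\triangleright\alpha_M(m)$, $\beta_M(a\triangleright m)=\beta_A(a)\triangleright\beta_M(m)$,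 $\alpha_A(a)\triangleright(b\triangleright m)=(ab)\triangleright\beta_M(m)$ for all $a,b\in A$, $m\in M$) with linear maps $R:A\to A$, $T:M\to M$ such that $T$ commutes with $\alpha_M,\beta_M$, $R$ commutes with $\alpha_A,\beta_A$, and $R(a)\triangleright T(m)=T(R(a)\triangleright m)+T(a\triangleright T(m))+\lambda T(a\triangleright m)$. A (left) BiHom-pre-Lie algebra $(A,\cdot,\alpha_A,\beta_A)$: a vector space with a bilinear operation $\cdot$ and commuting linear maps $\alpha_A,\beta_A$ multiplicative for $\cdot$ with $\alpha_A\beta_A(a)\cdot(\alpha_A(b)\cdot c)-(\beta_A(a)\cdot\alpha_A(b))\cdot\beta_A(c)=\alpha_A\beta_A(b)\cdot(\alpha_A(a)\cdot c)-(\beta_A(b)\cdot\alpha_A(a))\cdot\beta_A(c)$. A left pre-Lie module over a BiHom-pre-Lie algebra $(A,\cdot,\alpha_A,\beta_A)$ is $(M,\triangleright,\alpha_M,\beta_M)$ with $\alpha_M\beta_M=\beta_M\alpha_M$, $\alpha_M(a\triangleright m)=\alpha_A(a)\triangleright\alpha_M(m)$, $\beta_M(a\triangleright m)=\beta_A(a)\triangleright\beta_M(m)$ and $\alpha_A\beta_A(a)\triangleright(\alpha_A(b)\triangleright m)-(\beta_A(a)\cdot\alpha_A(b))\triangleright\beta_M(m)=\alpha_A\beta_A(b)\triangleright(\alpha_A(a)\triangleright m)-(\beta_A(b)\cdot\alpha_A(a))\triangleright\beta_M(m)$ for all $a,b\in A$, $m\in M$. *)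

(* Defs.v *)
From HB Require Import structures.
From mathcomp Require Import all_boot all_order all_algebra.

Set Implicit Arguments.
Unset Strict Implicit.
Unset Printing Implicit Defensive.

Import GRing.Theory.
Local Open Scope ring_scope.

Section BijectiveInverse.
Variables (T : choiceType) (f : T -> T).

Lemma bijective_surj : bijective f -> forall y, exists x, f x == y.
Proof. by move=> [g _ gK] y; exists (g y); rewrite gK. Qed.

Definition bij_inv (bij_f : bijective f) (y : T) : T :=
  xchoose (bijective_surj bij_f y).

Lemma bij_invK (bij_f : bijective f) : cancel (bij_inv bij_f) f.
Proof. by move=> y; apply/eqP; exact: (xchooseP (bijective_surj bij_f y)). Qed.

Lemma bij_invKV (bij_f : bijective f) : cancel f (bij_inv bij_f).
Proof. by move=> x; apply: (bij_inj bij_f); exact: bij_invK. Qed.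

End BijectiveInverse.

(* A linear map U (x) V -> W is encoded as a curried function together with a
   proof that it is bilinear. *)
Notation is_bilinear op := (bilinear_for *:%R *:%R op).

Section Structures.
Variable K : fieldType.

Record BiHom_associative (A : lmodType K) (mu : A -> A -> A)
    (alphaA betaA : {linear A -> A}) : Prop := {
  bha_bilinear : is_bilinear mu;
  bha_commute : forall a, alphaA (betaA a) = betaA (alphaA a);
  bha_alphaM : forall a b, alphaA (mu a b) = mu (alphaA a) (alphaA b);
  bha_betaM : forall a b, betaA (mu a b) = mu (betaA a) (betaA b);
  bha_assoc : forall a b c, mu (alphaA a) (mu b c) = mu (mu a b) (betaA c)
}.

Record RotaBaxter_BiHom_associative (lambda : K) (A : lmodType K)
    (mu : A -> A -> A) (R alphaA betaA : {linear A -> A}) : Prop := {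
  rb_assoc : BiHom_associative mu alphaA betaA;
  rb_alpha : forall a, R (alphaA a) = alphaA (R a);
  rb_beta : forall a, R (betaA a) = betaA (R a);
  rb_RotaBaxter : forall a b,
    mu (R a) (R b) = R (mu (R a) b) + R (mu a (R b)) + lambda *: R (mu a b)
}.

Record BiHom_left_module (A : lmodType K) (mu : A -> A -> A)
    (alphaA betaA : {linear A -> A}) (M : lmodType K) (act : A -> M -> M)
    (alphaM betaM : {linear M -> M}) : Prop := {
  blm_assoc : BiHom_associative mu alphaA betaA;
  blm_bilinear : is_bilinear act;
  blm_commute : forall m, alphaM (betaM m) = betaM (alphaM m);
  blm_alpha : forall a m, alphaM (act a m) = act (alphaA a) (alphaM m);
  blm_beta : forall a m, betaM (act a m) = act (betaA a) (betaM m);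
  blm_act : forall a b m,
    act (alphaA a) (act b m) = act (mu a b) (betaM m)
}.

Record RotaBaxter_paired_module (lambda : K) (A : lmodType K)
    (mu : A -> A -> A) (alphaA betaA : {linear A -> A})
    (M : lmodType K) (act : A -> M -> M)
    (R : {linear A -> A}) (T alphaM betaM : {linear M -> M}) : Prop := {
  rbm_module : BiHom_left_module mu alphaA betaA act alphaM betaM;
  rbm_T_alpha : forall m, T (alphaM m) = alphaM (T m);
  rbm_T_beta : forall m, T (betaM m) = betaM (T m);
  rbm_R_alpha : forall a, R (alphaA a) = alphaA (R a);
  rbm_R_beta : forall a, R (betaA a) = betaA (R a);
  rbm_RotaBaxter : forall a m,
    act (R a) (T m) =
      T (act (R a) m) + T (act a (T m)) + lambda *: T (act a m)
}.

Record BiHom_pre_Lie (A : lmodType K) (dot : A -> A -> A)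
    (alphaA betaA : {linear A -> A}) : Prop := {
  bpl_bilinear : is_bilinear dot;
  bpl_commute : forall a, alphaA (betaA a) = betaA (alphaA a);
  bpl_alphaM : forall a b, alphaA (dot a b) = dot (alphaA a) (alphaA b);
  bpl_betaM : forall a b, betaA (dot a b) = dot (betaA a) (betaA b);
  bpl_pre_Lie : forall a b c,
    dot (alphaA (betaA a)) (dot (alphaA b) c)
      - dot (dot (betaA a) (alphaA b)) (betaA c)
    = dot (alphaA (betaA b)) (dot (alphaA a) c)
      - dot (dot (betaA b) (alphaA a)) (betaA c)
}.

Record left_pre_Lie_module (A : lmodType K) (dot : A -> A -> A)
    (alphaA betaA : {linear A -> A}) (M : lmodType K) (act : A -> M -> M)
    (alphaM betaM : {linear M -> M}) : Prop := {
  plm_pre_Lie : BiHom_pre_Lie dot alphaA betaA;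
  plm_bilinear : is_bilinear act;
  plm_commute : forall m, alphaM (betaM m) = betaM (alphaM m);
  plm_alpha : forall a m, alphaM (act a m) = act (alphaA a) (alphaM m);
  plm_beta : forall a m, betaM (act a m) = act (betaA a) (betaM m);
  plm_act : forall a b m,
    act (alphaA (betaA a)) (act (alphaA b) m)
      - act (dot (betaA a) (alphaA b)) (betaM m)
    = act (alphaA (betaA b)) (act (alphaA a) m)
      - act (dot (betaA b) (alphaA a)) (betaM m)
}.

Definition star_action (lambda : K) (A M : lmodType K) (act : A -> M -> M)
    (R : {linear A -> A}) (T : {linear M -> M}) (a : A) (m : M) : M :=
  act (R a) m + act a (T m) + lambda *: act a m.

Definition natural_product (lambda : K) (A : lmodType K) (mu : A -> A -> A)
    (R alphaA betaA : {linear A -> A})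
    (bij_alpha : bijective alphaA) (bij_beta : bijective betaA)
    (a b : A) : A :=
  let alphaA_inv := bij_inv bij_alpha in
  let betaA_inv := bij_inv bij_beta in
  mu (R a) b
    - mu (alphaA_inv (betaA b)) (R (alphaA (betaA_inv a)))
    - lambda *: mu (alphaA_inv (betaA b)) (alphaA (betaA_inv a)).

End Structures.

(* Main.v *)
Require Import Defs.
From HB Require Import structures.
From mathcomp Require Import all_boot all_order all_algebra.

Set Implicit Arguments.
Unset Strict Implicit.
Unset Printing Implicit Defensive.

Import GRing.Theory.
Local Open Scope ring_scope.

(** Put [R' = R + lambda] and [T' = T + lambda]. Then

    - the star action is [a * m = R a |> m + a |> T' m], and taking [M = A],
      [T = R] it gives a product [a * b = R a b + a R' b] on [A];
    - the Rota-Baxter identities say exactly that [T (a * m) = R a |> T m], and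
      they imply [T' (a * m) = R' a |> T' m]; so [R] and [R'] are both
      multiplicative from the star product to [mu];
    - consequently the star action is an action of the star product:
      [alpha a * (b * m) = (a * b) * beta m] ([star_action_assoc]).

    The product [natural] is the star product up to a symmetric term. As [alpha]
    and [beta] are onto, [natural] is determined by

      [natural (beta a) (alpha b) = R (beta a) (alpha b) - beta b (R' (alpha a))],

    so that [beta a * alpha b - natural (beta a) (alpha b)]
    [= beta a (R' (alpha b)) + beta b (R' (alpha a))], which is invariant under
    exchanging [a] and [b] ([star_natural_sym]). By associativity of the star
    action, the two sides of the module identity are this element and its mirror
    image, acting on [beta m].

    That [natural] is itself pre-Lie also comes down to this symmetry. Left
    multiplication by [R a] and right multiplication by [R' b] make [A] a
    bimodule over the star product, and [natural] is the left action minus the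
    right one, twisted by [alpha] and [beta]. Expanding the double product of
    [alpha (beta a)], [alpha b] and [c] gives a left-left term, where the star
    product of [beta a] and [alpha b] acts on the left, a right-right term, where
    that of [beta b] and [alpha a] acts on the right, and two mixed terms, which
    by associativity are exchanged when [a] and [b] are. So the double product is
    symmetric up to [natural (beta a * alpha b) (beta c)], and [star_natural_sym]
    replaces this star product by [natural]. Writing the arguments as images
    under [alpha] and [beta] keeps inverses out of the computation. *)

(** * Bilinear maps and shifted operators *)

Section Bilinear.
Variables (K : fieldType) (U V W : lmodType K) (op : U -> V -> W).
Hypothesis op_bil : is_bilinear op.

Lemma bilinearPl k x y v : op (k *: x + y) v = k *: op x v + op y v.
Proof. exact: op_bil.1. Qed.

Lemma bilinearPr k u x y : op u (k *: x + y) = k *: op u x + op u y.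
Proof. exact: op_bil.2. Qed.

Lemma bilinearDl x y v : op (x + y) v = op x v + op y v.
Proof. by rewrite -[x in LHS]scale1r bilinearPl scale1r. Qed.

Lemma bilinearDr u x y : op u (x + y) = op u x + op u y.
Proof. by rewrite -[x in LHS]scale1r bilinearPr scale1r. Qed.

Lemma bilinearBl x y v : op (x - y) v = op x v - op y v.
Proof. by rewrite addrC -scaleN1r bilinearPl scaleN1r addrC. Qed.

Lemma bilinearBr u x y : op u (x - y) = op u x - op u y.
Proof. by rewrite addrC -scaleN1r bilinearPr scaleN1r addrC. Qed.

Lemma bilinearZr k u x : op u (k *: x) = k *: op u x.
Proof.
have op0 : op u 0 = 0 by apply: (addrI (op u 0)); rewrite -bilinearDr !addr0.
by rewrite -[k *: x]addr0 bilinearPr op0 addr0.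
Qed.

Lemma bilinearZl k x v : op (k *: x) v = k *: op x v.
Proof.
have op0 : op 0 v = 0 by apply: (addrI (op 0 v)); rewrite -bilinearDl !addr0.
by rewrite -[k *: x]addr0 bilinearPl op0 addr0.
Qed.

End Bilinear.

Definition shift (K : fieldType) (lambda : K) (V : lmodType K)
    (f : {linear V -> V}) : {linear V -> V} := f \+ lambda \*: idfun.

Lemma shiftE (K : fieldType) (lambda : K) (V : lmodType K)
    (f : {linear V -> V}) x : shift lambda f x = f x + lambda *: x.
Proof. by []. Qed.

Lemma shift_comm (K : fieldType) (lambda : K) (V : lmodType K)
    (f g : {linear V -> V}) :
  (forall x, f (g x) = g (f x)) ->
  forall x, shift lambda f (g x) = g (shift lambda f x).
Proof. by move=> fg x; rewrite !shiftE linearD linearZ /= fg. Qed.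

(** * The star action *)

Section StarAction.
Variables (K : fieldType) (lambda : K) (A : lmodType K) (mu : A -> A -> A).
Variables (R alphaA betaA : {linear A -> A}).

(** This lets every fact about the star action be reused for the star product
    [star_action lambda mu R R] of [A]. *)
Lemma regular_paired_module :
  RotaBaxter_BiHom_associative lambda mu R alphaA betaA ->
  RotaBaxter_paired_module lambda mu alphaA betaA mu R R alphaA betaA.
Proof.
case=> bha R_alpha R_beta R_RB; split=> //.
by split=> //; case: bha.
Qed.

Variables (M : lmodType K) (act : A -> M -> M) (T alphaM betaM : {linear M -> M}).
Hypothesis RB_M :
  RotaBaxter_paired_module lambda mu alphaA betaA act R T alphaM betaM.

Let act_bil : is_bilinear act := blm_bilinear (rbm_module RB_M).

Lemma star_actionE a m :
  star_action lambda act R T a m = act (R a) m + act a (shift lambda T m).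
Proof.
by rewrite /star_action shiftE (bilinearDr act_bil) (bilinearZr act_bil) addrA.
Qed.

Lemma star_action_bilinear : is_bilinear (star_action lambda act R T).
Proof.
split=> [m k a b | a k m n]; rewrite /= !star_actionE linearP.
  by rewrite !(bilinearPl act_bil) scalerDr addrACA.
by rewrite !(bilinearPr act_bil) scalerDr addrACA.
Qed.

Lemma star_action_alpha a m :
  alphaM (star_action lambda act R T a m)
    = star_action lambda act R T (alphaA a) (alphaM m).
Proof.
rewrite !star_actionE linearD /= !(blm_alpha (rbm_module RB_M)).
by rewrite -(rbm_R_alpha RB_M) -(shift_comm _ (rbm_T_alpha RB_M)).
Qed.

Lemma star_action_beta a m :
  betaM (star_action lambda act R T a m)
    = star_action lambda act R T (betaA a) (betaM m).
Proof.
rewrite !star_actionE linearD /= !(blm_beta (rbm_module RB_M)).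
by rewrite -(rbm_R_beta RB_M) -(shift_comm _ (rbm_T_beta RB_M)).
Qed.

Lemma star_action_T a m : T (star_action lambda act R T a m) = act (R a) (T m).
Proof. by rewrite /star_action !linearD linearZ (rbm_RotaBaxter RB_M). Qed.

(** [T'] turns the star action into the action twisted by [R']: expanding
    [R' a |> T' m], the terms in [lambda] are [lambda] times the star action. *)
Lemma star_action_shift a m :
  shift lambda T (star_action lambda act R T a m)
    = act (shift lambda R a) (shift lambda T m).
Proof.
rewrite [LHS]shiftE star_action_T star_actionE !shiftE.
rewrite [act (_ + _) _](bilinearDl act_bil) [act (R a) (_ + _)](bilinearDr act_bil).
by rewrite (bilinearZl act_bil) (bilinearZr act_bil) -addrA -scalerDr.
Qed.

End StarAction.

Section StarAssociativity.
Variables (K : fieldType) (lambda : K) (A : lmodType K) (mu : A -> A -> A).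
Variables (R alphaA betaA : {linear A -> A}).
Hypothesis RB_A : RotaBaxter_BiHom_associative lambda mu R alphaA betaA.
Variables (M : lmodType K) (act : A -> M -> M) (T alphaM betaM : {linear M -> M}).
Hypothesis RB_M :
  RotaBaxter_paired_module lambda mu alphaA betaA act R T alphaM betaM.

(** Both sides are
    [(R a R b) |> beta m + (R a b + a R' b) |> beta (T' m)]: on the left by
    multiplicativity of [T'], on the right by that of [R]. *)
Lemma star_action_assoc a b m :
  star_action lambda act R T (alphaA a) (star_action lambda act R T b m)
    = star_action lambda act R T (star_action lambda mu R R a b) (betaM m).
Proof.
have RB_AA := regular_paired_module RB_A.
have act_bil := blm_bilinear (rbm_module RB_M).
rewrite (star_actionE RB_M) (star_action_shift RB_M) (star_actionE RB_M b).
rewrite (star_actionE RB_M _ (betaM m)) (star_action_T RB_AA).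
rewrite (star_actionE RB_AA) (shift_comm _ (rbm_T_beta RB_M)).
rewrite (rbm_R_alpha RB_M) (bilinearDr act_bil) (bilinearDl act_bil).
by rewrite !(blm_act (rbm_module RB_M)) addrA.
Qed.

End StarAssociativity.

(** * The pre-Lie product *)

Section NaturalProduct.
Variables (K : fieldType) (lambda : K) (A : lmodType K) (mu : A -> A -> A).
Variables (R alphaA betaA : {linear A -> A}).
Hypothesis RB_A : RotaBaxter_BiHom_associative lambda mu R alphaA betaA.
Variables (bij_alphaA : bijective alphaA) (bij_betaA : bijective betaA).

Let bha := rb_assoc RB_A.
Let mu_bil : is_bilinear mu := bha_bilinear bha.
Let alpha_beta := bha_commute bha.
Let RB_AA := regular_paired_module RB_A.

Local Notation R' := (shift lambda R).
Local Notation star := (star_action lambda mu R R).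
Local Notation natural :=
  (natural_product lambda mu R bij_alphaA bij_betaA).

Let R'_alpha := shift_comm lambda (rb_alpha RB_A).
Let R'_beta := shift_comm lambda (rb_beta RB_A).

Let alphaV x : exists y, x = alphaA y.
Proof. by exists (bij_inv bij_alphaA x); rewrite bij_invK. Qed.

Let betaV x : exists y, x = betaA y.
Proof. by exists (bij_inv bij_betaA x); rewrite bij_invK. Qed.

(** Surjectivity of [alphaA] and [betaA] makes this a full description of
    [natural], free of inverses. *)
Lemma naturalE a b :
  natural (betaA a) (alphaA b)
    = mu (R (betaA a)) (alphaA b) - mu (betaA b) (R' (alphaA a)).
Proof.
rewrite /natural_product -alpha_beta !bij_invKV shiftE (bilinearDr mu_bil).
by rewrite (bilinearZr mu_bil) opprD addrA.
Qed.

Lemma natural_bilinear : is_bilinear natural.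
Proof.
split=> [y k x z | x k y z] /=.
  have [[[b ->] [a ->]] [c ->]] := (alphaV y, betaV x, betaV z).
  rewrite -linearP !naturalE !linearP (bilinearPl mu_bil) (bilinearPr mu_bil).
  by rewrite scalerBr opprD addrACA.
have [[[a ->] [b ->]] [c ->]] := (betaV x, alphaV y, alphaV z).
rewrite -linearP !naturalE !linearP (bilinearPl mu_bil) (bilinearPr mu_bil).
by rewrite scalerBr opprD addrACA.
Qed.

Lemma natural_alpha a b : alphaA (natural a b) = natural (alphaA a) (alphaA b).
Proof.
have [[x ->] [y ->]] := (betaV a, alphaV b).
rewrite alpha_beta !naturalE linearB /= !(bha_alphaM bha).
by rewrite -!(rb_alpha RB_A) -!R'_alpha !alpha_beta.
Qed.

Lemma natural_beta a b : betaA (natural a b) = natural (betaA a) (betaA b).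
Proof.
have [[x ->] [y ->]] := (betaV a, alphaV b).
rewrite -alpha_beta !naturalE linearB /= !(bha_betaM bha).
by rewrite -!(rb_beta RB_A) -!R'_beta -!alpha_beta.
Qed.

(** The difference is
    [beta a (R' (alpha b)) + beta b (R' (alpha a))]. *)
Lemma star_natural_sym a b :
  star (betaA a) (alphaA b) - natural (betaA a) (alphaA b)
    = star (betaA b) (alphaA a) - natural (betaA b) (alphaA a).
Proof.
have star_natural x y : star (betaA x) (alphaA y) - natural (betaA x) (alphaA y)
    = mu (betaA x) (R' (alphaA y)) + mu (betaA y) (R' (alphaA x)).
  rewrite (star_actionE RB_AA) naturalE opprB [X in _ + X]addrC.
  by rewrite addrACA subrr add0r.
by rewrite !star_natural addrC.
Qed.

(** A double left multiplication by [natural] is one left multiplication by the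
    star product, up to symmetric terms. The left-left term is exactly accounted
    for by the star product. What remains is a pair of mixed terms and a pair of
    terms with two right multiplications, one of which comes from each product;
    [a] and [b] play exchanged roles in the members of each pair. *)
Lemma natural_natural_sym a b c :
  natural (alphaA (betaA a)) (natural (alphaA b) c)
      - natural (star (betaA a) (alphaA b)) (betaA c)
    = natural (alphaA (betaA b)) (natural (alphaA a) c)
      - natural (star (betaA b) (alphaA a)) (betaA c).
Proof.
have [[[x ->] [y ->]] [c1 ->]] := (betaV a, betaV b, alphaV c).
have [z ->] := alphaV c1; move: x y => {a b c c1}.
pose mixed x y :=
  mu (mu (R (betaA (betaA x))) (alphaA (betaA z)))
     (R' (betaA (alphaA (alphaA y)))).
pose right2 x y :=
  mu (betaA (betaA (alphaA z)))
     (mu (R' (alphaA (betaA x))) (R' (alphaA (alphaA y)))).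
suff expand x y :
    natural (alphaA (betaA (betaA x)))
            (natural (alphaA (betaA y)) (alphaA (alphaA z)))
      - natural (star (betaA (betaA x)) (alphaA (betaA y)))
                (betaA (alphaA (alphaA z)))
    = (right2 y x + right2 x y) - (mixed x y + mixed y x).
  move=> x y; rewrite !expand.
  by rewrite [right2 y x + _]addrC [mixed x y + _]addrC.
(* The inner product is the image under [alphaA] of [w], as [naturalE] needs. *)
pose w := mu (R (betaA y)) (alphaA z) - mu (betaA z) (R' (alphaA y)).
have inner : natural (alphaA (betaA y)) (alphaA (alphaA z)) = alphaA w.
  by rewrite -natural_alpha naturalE.
have star_beta : star (betaA (betaA x)) (alphaA (betaA y))
    = betaA (star (betaA x) (alphaA y)).
  by rewrite (star_action_beta RB_AA) alpha_beta.
pose pushR := (rb_alpha RB_A, rb_beta RB_A, R'_alpha, R'_beta).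
have left_w : mu (R (betaA (alphaA (betaA x)))) (alphaA w)
    = mu (mu (R (betaA (betaA x))) (R (alphaA (betaA y))))
         (betaA (alphaA (alphaA z))) - mixed x y.
  rewrite -alpha_beta (rb_alpha RB_A) linearB (bilinearBr mu_bil).
  by rewrite !(bha_alphaM bha) !(bha_assoc bha) /mixed !pushR.
have right_w : mu (betaA w) (R' (alphaA (alphaA (betaA x))))
    = mixed y x - right2 y x.
  rewrite !alpha_beta R'_beta linearB (bilinearBl mu_bil).
  rewrite /mixed /right2 !R'_beta !(bha_betaM bha) -!(bha_assoc bha).
  by rewrite !pushR !alpha_beta.
rewrite inner alpha_beta naturalE star_beta -(alpha_beta (alphaA z)) naturalE.
rewrite left_w right_w -star_beta (star_action_T RB_AA).
rewrite (star_action_alpha RB_AA) (star_action_shift RB_AA) -/(right2 x y).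
rewrite (alpha_beta (alphaA z)) !opprB opprD.
by rewrite [LHS](AC ((2*2)*2) ((3*5)*(2*4)*(1*6))) /= subrr addr0.
Qed.

Lemma natural_pre_Lie : BiHom_pre_Lie natural alphaA betaA.
Proof.
split; [exact: natural_bilinear | exact: alpha_beta | exact: natural_alpha
  | exact: natural_beta | move=> a b c].
have split_star x y :
    natural (alphaA (betaA x)) (natural (alphaA y) c)
      - natural (natural (betaA x) (alphaA y)) (betaA c)
    = (natural (alphaA (betaA x)) (natural (alphaA y) c)
        - natural (star (betaA x) (alphaA y)) (betaA c))
      + natural (star (betaA x) (alphaA y) - natural (betaA x) (alphaA y))
                (betaA c).
  by rewrite [in RHS](bilinearBl natural_bilinear) addrA subrK.
by rewrite !split_star natural_natural_sym star_natural_sym.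
Qed.

End NaturalProduct.

Theorem theorem3p13 (K : fieldType) (lambda : K)
    (A : lmodType K) (mu : A -> A -> A) (R alphaA betaA : {linear A -> A})
    (RB_A : RotaBaxter_BiHom_associative lambda mu R alphaA betaA)
    (bij_alphaA : bijective alphaA) (bij_betaA : bijective betaA)
    (M : lmodType K) (act : A -> M -> M) (T alphaM betaM : {linear M -> M})
    (RB_M : RotaBaxter_paired_module lambda mu alphaA betaA
              act R T alphaM betaM) :
  left_pre_Lie_module (natural_product lambda mu R bij_alphaA bij_betaA)
    alphaA betaA (star_action lambda act R T) alphaM betaM.
Proof.
have act_bil := star_action_bilinear RB_M.
split=> [||m|a m|a m|a b m].
- exact: natural_pre_Lie.
- exact: act_bil.
- exact: blm_commute (rbm_module RB_M) m.
- exact: (star_action_alpha RB_M).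
- exact: (star_action_beta RB_M).
rewrite !(star_action_assoc RB_A RB_M) -!(bilinearBl act_bil).
by rewrite (star_natural_sym RB_A).
Qed.
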